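(* If $T$ is a tree of order $n$ with independence number $\alpha=\alpha(T)$, then $$\mathrm{aecc}_3(T)\ge \mathrm{aecc}_3(T_{n,\alpha}).$$
   Context: For a connected graph $G$ with $n(G)$ vertices and $S\subseteq V(G)$, the Steiner distance $d_G(S)$ is the minimum number of edges of a connected subgraph of $G$ containing $S$. For $v\in V(G)$, $\mathrm{ecc}_3(v,G)=\max\{d_G(S): v\in S\subseteq V(G), |S|=3\}$, and $\mathrm{aecc}_3(G)=\frac{1}{n(G)}\sum_{v\in V(G)}\mathrm{ecc}_3(v,G)$. The independence number $\alpha(T)$ is the maximum cardinality of an independent set of vertices of $T$. For $m\ge 3$ and $m+2\le n\le 2m+1$, $T_{n,m}$ is the tree of order $n$ obtained from the star $K_{1,m}$ by adding one pendent edge to each of $n-m-1$ of its pendent vertices (so a leaf is added to at least one and at most $m$ of the leaves of $K_{1,m}$). *)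

(* Defs.v *)
From mathcomp Require Import all_boot all_order all_algebra.
Set Implicit Arguments.
Unset Strict Implicit.
Unset Printing Implicit Defensive.
Import Order.TTheory GRing.Theory Num.Theory.

Record sgraph := SGraph {
  vertex :> finType;
  adj : rel vertex;
  adj_sym : symmetric adj;
  adj_irrefl : irreflexive adj }.

Definition edges (G : sgraph) : {set {set G}} :=
  [set [set p.1; p.2] | p : G * G & adj p.1 p.2].

Definition connected (G : sgraph) : Prop :=
  (0 < #|G|) /\ forall x y : G, connect (@adj G) x y.

Definition acyclic (G : sgraph) : Prop :=
  forall c : seq G, 2 < size c -> ~ ucycle (@adj G) c.

Definition is_tree (G : sgraph) : Prop := connected G /\ acyclic G.

Definition independent (G : sgraph) (A : {set G}) : bool :=
  [forall x in A, forall y in A, ~~ adj x y].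

Definition alpha (G : sgraph) : nat :=
  \max_(A : {set G} | independent A) #|A|.

(* A subgraph is a pair H = (vertex set, edge set). *)
Definition is_subgraph (G : sgraph) (H : {set G} * {set {set G}}) : bool :=
  (H.2 \subset edges G) && [forall f in H.2, f \subset H.1].

Definition subgraph_connected (G : sgraph)
    (H : {set G} * {set {set G}}) : bool :=
  (H.1 != set0) &&
  [forall x in H.1, forall y in H.1,
     connect (fun u v : G => [set u; v] \in H.2) x y].

Definition connects (G : sgraph) (S : {set G})
    (H : {set G} * {set {set G}}) : bool :=
  [&& is_subgraph H, subgraph_connected H & S \subset H.1].

(* The starting point of the arg min is G itself; it satisfies the condition
   whenever G is connected, so the value is then the true minimum. *)
Definition steiner_dist (G : sgraph) (S : {set G}) : nat :=
  #|([arg min_(H < ([set: G], edges G) | connects S H) #|H.2| ]).2|.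

(* The maximum is over a nonempty family as soon as G has 3 vertices. *)
Definition ecc3 (G : sgraph) (v : G) : nat :=
  \max_(S : {set G} | (v \in S) && (#|S| == 3)) steiner_dist S.

Definition aecc3 (G : sgraph) : rat :=
  ((\sum_(v : G) ecc3 v)%N%:R / #|G|%:R)%R.

(* T_{n,m}, for m + 1 <= n <= 2 m + 1: [inl (inl tt)] is the centre of the star
   K_{1,m}, [inl (inr i)] its i-th leaf, and [inr j] the new leaf attached to
   the j-th leaf of the star, for j < n - m - 1. *)
Definition Tvertex (n m : nat) : finType :=
  (unit + 'I_m + 'I_(n - m - 1))%type.

Definition Tadj (n m : nat) : rel (Tvertex n m) := fun x y =>
  match x, y with
  | inl (inl _), inl (inr _) | inl (inr _), inl (inl _) => true
  | inl (inr i), inr j | inr j, inl (inr i) => i == j :> nat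
  | _, _ => false
  end.

Lemma Tadj_sym n m : symmetric (@Tadj n m).
Proof. by move=> [[[]|i]|j] [[[]|i']|j']. Qed.

Lemma Tadj_irrefl n m : irreflexive (@Tadj n m).
Proof. by move=> [[[]|i]|j]. Qed.

Definition Tnm (n m : nat) : sgraph :=
  SGraph (@Tadj_sym n m) (@Tadj_irrefl n m).

Lemma card_Tnm n m : m < n -> #|Tnm n m| = n.
Proof.
move=> mn; rewrite !card_sum card_unit !card_ord -addnA -subnDA addn1 addnCA.
by rewrite addnA addn1 subnKC.
Qed.

(* Main.v *)
(* Write k = n - alpha - 1. In T_{n,alpha} a vertex has ecc3 at most 4, 5 or 6
   according to its depth, and summing (with sharper values when k <= 2) gives
     sum ecc3 <= (k + 3) n - (k + 1)   if k <= 2,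
     sum ecc3 <= 6 n - (alpha + 2)     if k >= 3.
   In a tree T a path with r + 2 vertices forces ecc3 >= r + 1 everywhere, and
   ecc3 >= r + 2 off its r interior vertices as soon as some vertex lies outside
   the path; hence sum ecc3 >= (r + 2) n - r, while for a spanning path
   ecc3 = n - 1 everywhere, its largest possible value. If the longest path has 3 (resp. 4) vertices, deleting its interior leaves an independent
   set, so k = 0 (resp. k <= 1). This settles every case except a longest path
   with 5 vertices and k >= 3: then T has depth 2 around the centre c of that
   path, deleting c and its non-leaf neighbours leaves an independent set, so c
   has at least 3 non-leaf neighbours; ecc3 is then at least 4 at c, 5 on N(c) and
   6 elsewhere, and N(c) is independent, so sum ecc3 >= 6 n - 2 - alpha. *)
Require Import Defs.
From mathcomp Require Import all_boot all_order all_algebra.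
From mathcomp Require Import zify.

Set Implicit Arguments.
Unset Strict Implicit.
Unset Printing Implicit Defensive.
Import Order.TTheory GRing.Theory Num.Theory.

(** * Walks in acyclic graphs *)

Section Walks.

Variable G : sgraph.
Implicit Types (x y z : G) (p q s : seq G).

(* Non-backtracking walks; in an acyclic graph these are exactly the simple paths,
   so simplicity becomes a local condition. *)
Fixpoint nbwalk s : bool :=
  if s is x :: s' then
    (if s' is y :: s'' then adj x y && (if s'' is z :: _ then x != z else true)
     else true) && nbwalk s'
  else true.

Lemma nbwalk_path x s : nbwalk (x :: s) -> path (@adj G) x s.
Proof.
elim: s x => [//|y s IHs] x /= /andP[/andP[-> _] nb_ys].
exact: (IHs y nb_ys).
Qed.

(** If the head recurred in the duplicate-free tail, the stretch up to that recurrence would be a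
    loop, a backtrack or a cycle of length at least 3. *)
Lemma nbwalk_uniq s : acyclic G -> nbwalk s -> uniq s.
Proof.
move=> acG; elim: s => [//|x s IHs] nb_xs.
have nb_s : nbwalk s by case/andP: nb_xs.
have s_uniq := IHs nb_s; rewrite cons_uniq s_uniq andbT.
apply/negP=> xs; have:= nbwalk_path nb_xs.
case/splitPr: xs => p1 p2 in s_uniq nb_s nb_xs {IHs} *.
rewrite -cat_rcons cat_path => /andP[cyc _].
have x_p1 : uniq (x :: p1).
  by move: s_uniq; rewrite -cat_rcons cat_uniq rcons_uniq => /andP[].
case: p1 => [|y [|z p1]] in cyc x_p1 nb_xs {s_uniq nb_s} *.
- by rewrite /= adj_irrefl in cyc.
- by rewrite /= eqxx andbF in nb_xs.
by apply: (acG [:: x, y, z & p1]) => //; rewrite /ucycle /= in cyc *; apply/andP.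
Qed.

Lemma uniq_path_nbwalk x p :
  path (@adj G) x p -> uniq (x :: p) -> nbwalk (x :: p).
Proof.
elim: p x => [//|y p IHp] x /andP[xy y_p] /andP[x_yp yp_uniq].
apply/andP; split; last exact: IHp.
rewrite xy; case: p x_yp {IHp y_p yp_uniq} => [//|z p].
by rewrite !inE !negb_or => /and3P[].
Qed.

(** Glues two walks leaving [x] into one passing through [x]. Backtracking can only arise at [x],
    hence the condition on the two first steps. *)
Lemma nbwalk_catrev x p q :
  path (@adj G) x p -> uniq (x :: p) -> nbwalk (x :: q) ->
  (if p is a :: _ then if q is b :: _ then a != b else true else true) ->
  nbwalk (catrev p (x :: q)).
Proof.
elim: p x q => [//|a p IHp] x q /= /andP[xa a_p] /andP[x_ap ap_uniq] nb_xq a_q.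
apply: IHp => //; last first.
  case: p {a_p ap_uniq} x_ap => [//|b p].
  by rewrite !inE !negb_or [b == x]eq_sym => /and3P[].
by rewrite /= adj_sym xa a_q.
Qed.

Definition simple_path x y p :=
  [&& path (@adj G) x p, last x p == y & uniq (x :: p)].

Lemma simple_path_cons x y z p :
  simple_path x y (z :: p) -> adj x z /\ simple_path z y p.
Proof.
rewrite /simple_path cons_uniq /= => /and3P[/andP[xz z_p] z_y /andP[_ zp]].
by split=> //; apply/and3P.
Qed.

Lemma simple_path_refl x p : simple_path x x p -> p = [::].
Proof.
case: p => [//|a p] /and3P[_ /eqP ap_x /andP[/negP[]]].
by rewrite -[X in X \in _]ap_x; exact: (mem_last a p).
Qed.

(** Where the paths diverge, reversing one and continuing along the other does not backtrack, so it
    is duplicate-free, although [y] is at both ends. *)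
Lemma simple_path_unique x y p q : acyclic G ->
  simple_path x y p -> simple_path x y q -> p = q.
Proof.
move=> acG; elim: p x q => [|a p IHp] x [|b q] //.
- by case/and3P=> _ /= /eqP-> _ /simple_path_refl.
- by move=> xp /and3P[_ /eqP xy _]; rewrite -xy in xp; apply: simple_path_refl xp.
move=> xp xq; case: (eqVneq a b) => [eq_ab | neq_ab].
  rewrite -eq_ab in xq *; congr cons; apply: (IHp a).
    by case/simple_path_cons: xp.
  by case/simple_path_cons: xq.
case/and3P: xp => px lx ux; case/and3P: xq => qx mx vx.
have nb_xq : nbwalk (x :: b :: q) by apply: uniq_path_nbwalk.
have := nbwalk_uniq acG (nbwalk_catrev px ux nb_xq neq_ab).
rewrite catrevE cat_uniq => /and3P[_ /hasPn/(_ y) + _].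
have y_bq : y \in b :: q by rewrite -(eqP mx); exact: (mem_last b q).
rewrite mem_rev inE y_bq orbT => /(_ isT)/negP[].
by rewrite -(eqP lx); exact: (mem_last a p).
Qed.
End Walks.

(** * Steiner distance in trees *)

Lemma edges_adj (G : sgraph) (x y : G) : ([set x; y] \in edges G) = adj x y.
Proof.
apply/imsetP/idP => [[[a b]] | xy]; last by exists (x, y); rewrite ?inE.
rewrite inE /= => ab eq_xy.
have neq_ab : a != b by apply: contraTneq ab => ->; rewrite adj_irrefl.
have : x \in [set a; b] by rewrite -eq_xy set21.
have : y \in [set a; b] by rewrite -eq_xy set22.
rewrite !inE => /orP[]/eqP y_eq /orP[]/eqP x_eq.
all: rewrite x_eq y_eq ?ab 1?adj_sym ?ab //.
  have := set22 a b; rewrite -eq_xy x_eq y_eq !inE ?orbb.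
  by rewrite eq_sym (negPf neq_ab).
have := set21 a b; rewrite -eq_xy x_eq y_eq !inE ?orbb.
by rewrite (negPf neq_ab).
Qed.

Lemma connects_adj (G : sgraph) (S : {set G}) H (x y : G) :
  connects S H -> [set x; y] \in H.2 -> adj x y.
Proof.
case/and3P=> /andP[/subsetP H_edges _] _ _ /H_edges.
by rewrite edges_adj.
Qed.

Lemma connects_simple_path (G : sgraph) (S : {set G}) H (x y : G) :
  connects S H -> x \in H.1 -> y \in H.1 ->
  exists2 p, simple_path x y p & path (fun u v => [set u; v] \in H.2) x p.
Proof.
move=> cSH; have Hadj := connects_adj cSH.
case/and3P: cSH => _ /andP[_ /forall_inP Hconn] _ xH yH.
have /forall_inP/(_ y yH)/connectP[p0 + ->] := Hconn x xH.
case/shortenP=> p x_p p_uniq _; exists p => //.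
rewrite /simple_path eqxx p_uniq !andbT.
by apply: sub_path x_p => u v; apply: Hadj.
Qed.

(** The subgraph contains some simple path from [x] to [y], which by uniqueness is [p]. *)
Lemma connects_hull (G : sgraph) (S : {set G}) H (x y z : G) p :
  acyclic G -> connects S H -> x \in S -> y \in S ->
  simple_path x y p -> z \in x :: p -> z \in H.1.
Proof.
move=> acG cSH xS yS xp.
case/and3P: (cSH) => /andP[_ /forall_inP Hedge] _ /subsetP sSH.
have [q xq] := connects_simple_path cSH (sSH x xS) (sSH y yS).
rewrite (simple_path_unique acG xp xq) => {p xp xq}.
elim: q x {xS} (sSH x xS) => [|a q IHq] x xH /=; first by rewrite inE => _ /eqP->.
case/andP=> xa a_q; rewrite inE => /predU1P[-> // |]; apply: IHq => //.
by apply: (subsetP (Hedge _ xa)); rewrite set22.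
Qed.

(* Each vertex other than a root r is charged its first edge towards r. *)
Lemma connects_card (G : sgraph) (S : {set G}) H :
  acyclic G -> connects S H -> #|H.1| <= #|H.2|.+1.
Proof.
move=> acG cSH.
case/and3P: (cSH) => _ /andP[/set0Pn[r rH] _] _.
have /fin_all_exists[f fP] : forall x : G, exists f : {set G},
    x \in H.1 :\ r -> f \in H.2 /\
    exists y p, f = [set x; y] /\ simple_path x r (y :: p).
  move=> x; case: (boolP (x \in _)) => [|_]; last by exists set0.
  case/setD1P=> xr xH; have [[|y p] xp px] := connects_simple_path cSH xH rH.
    by case/and3P: xp xr => _ /= ->.
  exists [set x; y] => _; split; first by case/andP: px.
  by exists y, p.
rewrite (cardsD1 r) rH add1n ltnS -(@card_in_imset _ _ f) => [|x x' xH x'H eq_f].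
  by apply/subset_leq_card/subsetP=> _ /imsetP[x xH ->]; case: (fP x xH).
have [_ [y [p [fx xp]]]] := fP x xH.
have [_ [y' [p' [fx' xp']]]] := fP x' x'H.
(* Distinct vertices charged the same edge would each be the other's next vertex towards [r]. *)
apply/eqP/idPn => neq_xx'.
have eq_xy' : x = y'.
  by have := set21 x y; rewrite -fx eq_f fx' !inE (negPf neq_xx') => /eqP.
have eq_x'y : x' = y.
  have := set21 x' y'; rewrite -fx' -eq_f fx !inE.
  by rewrite eq_sym (negPf neq_xx') => /eqP.
move: xp xp'; rewrite -eq_xy' -eq_x'y => xp xp'.
have [_ x'p] := simple_path_cons xp.
have eq_p := simple_path_unique acG x'p xp'.
by case/and3P: xp => _ _; rewrite eq_p /= !inE eqxx orbT.
Qed.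

Lemma connects_full (G : sgraph) (S : {set G}) :
  connected G -> connects S ([set: G], edges G).
Proof.
case=> G_gt0 Gconn; apply/and3P; split; rewrite ?subsetT //.
  rewrite /is_subgraph subxx /=; apply/forall_inP=> f _; exact: subsetT.
rewrite /subgraph_connected -card_gt0 cardsT G_gt0 /=.
apply/forall_inP=> x _; apply/forall_inP=> y _.
by rewrite (@eq_connect _ _ (@adj G)) // => u v; rewrite edges_adj.
Qed.

Lemma steiner_distP (G : sgraph) (S : {set G}) :
  connected G ->
  exists H, [/\ connects S H, steiner_dist S = #|H.2|
    & forall H', connects S H' -> #|H.2| <= #|H'.2| ].
Proof.
move=> Gconn; have fullP := connects_full S Gconn.
have := arg_minnP (fun H : {set G} * {set {set G}} => #|H.2|) fullP.
by rewrite /steiner_dist; case=> H cSH minH; exists H.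
Qed.

(** A subgraph connecting [S] contains all paths between terminals, hence [W], and has at most one
    vertex more than it has edges. *)
Lemma steiner_dist_ge (G : sgraph) (S : {set G}) (W : seq G) :
  is_tree G -> uniq W ->
  (forall z, z \in W -> exists x y p,
     [/\ x \in S, y \in S, simple_path x y p & z \in x :: p]) ->
  size W <= (steiner_dist S).+1.
Proof.
case=> Gconn acG W_uniq WS; have [H [cSH -> _]] := steiner_distP S Gconn.
apply: leq_trans (connects_card acG cSH).
rewrite -(card_uniqP W_uniq) subset_leq_card //.
apply/subsetP=> z /WS[x [y [p [xS yS xp zp]]]].
exact: connects_hull acG cSH xS yS xp zp.
Qed.

Lemma steiner_dist_le (G : sgraph) (S : {set G}) H :
  connected G -> connects S H -> steiner_dist S <= #|H.2|.
Proof.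
move=> Gconn cSH; have [H0 [_ -> minH0]] := steiner_distP S Gconn.
exact: minH0.
Qed.

Lemma exists_superset_card (X : finType) (A : {set X}) k :
  #|A| <= k <= #|X| -> exists2 B : {set X}, A \subset B & #|B| = k.
Proof.
case/andP=> Ak kX; elim: k Ak kX => [|k IHk] Ak kX.
  by exists A => //; apply/eqP; rewrite -leqn0.
move: Ak; rewrite leq_eqVlt => /predU1P[eq_A | Ak]; first by exists A.
have [B sAB Bk] := IHk Ak (ltnW kX).
have /card_gt0P[x xB] : 0 < #|~: B| by rewrite cardsCs setCK Bk subn_gt0.
exists (x |: B); first exact: subset_trans (subsetU1 _ _).
by rewrite cardsU1 -in_setC xB Bk.
Qed.

(** The terminals in [s] may repeat or be fewer than three; they are padded to a set of exactly
    three, whose hull still contains [W]. *)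
Lemma ecc3_ge (G : sgraph) (v : G) (s W : seq G) :
  is_tree G -> 3 <= #|G| -> v \in s -> size s <= 3 -> uniq W ->
  (forall z, z \in W -> exists x y p,
     [/\ x \in s, y \in s, simple_path x y p & z \in x :: p]) ->
  size W <= (ecc3 v).+1.
Proof.
move=> treeG G3 vs s3 W_uniq Ws.
have [|S sub_S S3] := @exists_superset_card G [set:: s] 3.
  by rewrite G3 andbT cardsE; apply: leq_trans (card_size s) s3.
have vS : v \in S by apply: (subsetP sub_S); rewrite inE.
apply: (@leq_trans (steiner_dist S).+1).
  apply: steiner_dist_ge => // z /Ws[x [y [p [x_s y_s xp zp]]]].
  by exists x, y, p; split=> //; apply: (subsetP sub_S); rewrite inE.
by rewrite ltnS /ecc3 (bigop.bigmax_sup S) // vS S3 eqxx.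
Qed.

(** * Paths and independent sets in trees *)

Lemma tree_simple_path (G : sgraph) (x y : G) :
  connected G -> exists p, simple_path x y p.
Proof.
case=> _ /(_ x y)/connectP[p0 + ->] => /shortenP[p xp p_uniq _].
by exists p; rewrite /simple_path xp eqxx p_uniq.
Qed.

Lemma independent_card (G : sgraph) (A : {set G}) :
  (forall x y, x \in A -> y \in A -> ~~ adj x y) -> #|A| <= alpha G.
Proof.
move=> indA; rewrite /alpha; apply: (bigop.bigmax_sup A) => //.
by apply/forall_inP=> x xA; apply/forall_inP=> y yA; apply: indA.
Qed.

(** Connectedness and a second vertex produce an edge, so the full vertex set is not independent. *)
Lemma alpha_lt (G : sgraph) : connected G -> 1 < #|G| -> alpha G < #|G|.
Proof.
move=> Gconn G_gt1; rewrite /alpha -ltnS ltnS.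
suff H : forall A : {set G}, independent A -> #|A| < #|G|.
  rewrite -(prednK (ltnW G_gt1)) ltnS; apply/bigmax_leqP => A /H.
  by move=> ?; rewrite -ltnS prednK // ltnW.
move=> A /forall_inP indA; rewrite ltn_neqAle max_card andbT.
apply: contraTneq G_gt1 => A_full.
have inA x : x \in A.
  have /eqP-> : A == [set: G] by rewrite eqEcard subsetT cardsT A_full leqnn.
  by rewrite inE.
rewrite -leqNgt; apply/card_le1P => x _ y; rewrite !inE; symmetry; apply/eqP.
have [[|z p]] := tree_simple_path x y Gconn; first by case/and3P=> _ /eqP.
case/simple_path_cons=> xz _.
by have /forall_inP/(_ z (inA z)) := indA x (inA x); rewrite xz.
Qed.

(** Crossing an edge changes the distance to [r] by exactly one, which makes its parity a proper
    2-colouring. *)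
Lemma simple_path_adj (G : sgraph) (x y r : G) p :
  acyclic G -> adj x y -> simple_path x r p ->
  simple_path y r (x :: p) \/ exists2 q, p = y :: q & simple_path y r q.
Proof.
move=> acG xy xp.
case: p xp => [|a p] xp; last case: (eqVneq a y) => [eq_ay | neq_ay].
- left; case/and3P: xp => _ /eqP <- _.
  rewrite /simple_path /= adj_sym xy eqxx inE !andbT /=.
  by apply: contraTneq xy => ->; rewrite adj_irrefl.
- right; exists p; first by rewrite eq_ay.
  by rewrite eq_ay in xp; case/simple_path_cons: xp.
left; case/and3P: xp => x_p px_r p_uniq.
have nb_yxp : nbwalk [:: y, x, a & p].
  apply/andP; split; last exact: (uniq_path_nbwalk x_p p_uniq).
  by rewrite adj_sym xy eq_sym.
apply/and3P; split=> //; last exact: nbwalk_uniq nb_yxp.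
exact: nbwalk_path nb_yxp.
Qed.

(* Both parity classes of the distance to a root are independent. *)
Lemma tree_card_le_2alpha (G : sgraph) : is_tree G -> #|G| <= (alpha G).*2.
Proof.
case=> Gconn acG; have /card_gt0P[r _] := Gconn.1.
have [f fP] := fin_all_exists (fun x => tree_simple_path x r Gconn).
have f_adj x y : adj x y -> odd (size (f x)) = ~~ odd (size (f y)).
  move=> xy; case: (simple_path_adj acG xy (fP x)) => [yp | [p -> yp]].
    by rewrite (simple_path_unique acG (fP y) yp) /= negbK.
  by rewrite (simple_path_unique acG (fP y) yp).
pose A := [set x | odd (size (f x))].
rewrite -addnn -cardsT -(setUCr A).
apply: (leq_trans (leq_card_setU _ _)).
by apply: leq_add; apply: independent_card => x y; rewrite !inE => xA yA;
  apply/negP=> /f_adj xy; move: xA; rewrite xy ?yA // (negPf yA).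
Qed.

Lemma simple_path_rev (G : sgraph) (x y : G) p :
  simple_path x y p -> simple_path y x (rev (belast x p)).
Proof.
case/and3P=> x_p /eqP <- p_uniq; apply/and3P; split.
- by rewrite rev_path (eq_path (e' := @adj G)) // => u v; rewrite adj_sym.
- by case: p {x_p p_uniq} => //= a p; rewrite rev_cons last_rcons.
by rewrite -rev_rcons -lastI rev_uniq.
Qed.

(** * Lower bounds for trees *)

Definition has_path (G : sgraph) (k : nat) : Prop :=
  exists (x : G) p, [/\ path (@adj G) x p, uniq (x :: p) & size p = k].

Lemma has_path_le (G : sgraph) k l : l <= k -> has_path G k -> has_path G l.
Proof.
move=> le_lk [x [p [x_p p_uniq p_k]]]; exists x, (take l p); split.
- exact: take_path.
- exact: (take_uniq l.+1 p_uniq).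
by rewrite size_takel ?p_k.
Qed.

(* The head condition says that the two paths leave c through different edges. *)
Lemma has_path_join (G : sgraph) (c x h : G) p t :
  acyclic G -> simple_path c x p -> simple_path c (last h t) (h :: t) ->
  h != head c p -> has_path G (size p + (size t).+1).
Proof.
move=> acG /and3P[c_p _ p_uniq] /and3P[c_t _ t_uniq] h_p.
have nb_t := uniq_path_nbwalk c_t t_uniq.
have nbw : nbwalk (catrev p (c :: h :: t)).
  apply: nbwalk_catrev => //.
  by case: p h_p {c_p p_uniq} => // a p /=; rewrite eq_sym.
have: size (catrev p [:: c, h & t]) = (size p + (size t).+1).+1.
  by rewrite catrevE size_cat size_rev /= !addnS.
case: (catrev _ _) nbw => [//|y q] nb_yq [<-].
exists y, q; split=> //; first exact: nbwalk_path nb_yq.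
exact: nbwalk_uniq nb_yq.
Qed.

Lemma ecc3_ge_path (G : sgraph) (x v : G) p :
  is_tree G -> 3 <= #|G| -> path (@adj G) x p -> uniq (x :: p) ->
  size p <= ecc3 v.
Proof.
move=> treeG G3 x_p p_uniq; rewrite -ltnS -[(size p).+1]/(size (x :: p)).
apply: (@ecc3_ge _ _ [:: v; x; last x p]) => //; first by rewrite inE eqxx.
move=> z zp; exists x, (last x p), p.
by rewrite !inE !eqxx ?orbT; split=> //; apply/and3P.
Qed.

Lemma ecc3_gt_path (G : sgraph) (x z v : G) p :
  is_tree G -> 3 <= #|G| -> path (@adj G) x p -> uniq (x :: p) ->
  z \notin x :: p -> v \in [:: z; x; last x p] -> size p < ecc3 v.
Proof.
move=> treeG G3 x_p p_uniq zp v_s.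
rewrite -ltnS -[(size p).+2]/(size [:: z, x & p]).
apply: (@ecc3_ge _ _ [:: z; x; last x p]) => //; first by rewrite cons_uniq zp.
move=> w; rewrite in_cons => /predU1P[-> | wp].
  exists z, z, [::]; rewrite !inE !eqxx; split=> //.
  by rewrite /simple_path /= eqxx.
exists x, (last x p), p.
by rewrite !inE !eqxx ?orbT; split=> //; apply/and3P.
Qed.

(** The second term of the minimum serves a spanning path, the first a path that misses some
    vertex. *)
Lemma sum_ecc3_ge (G : sgraph) r :
  is_tree G -> 3 <= #|G| -> has_path G r.+1 ->
  minn (r.+2 * #|G| - r) (#|G|.-1 * #|G|) <= \sum_(v : G) ecc3 v.
Proof.
move=> treeG G3 [x [p [x_p p_uniq p_r]]].
have := max_card [set:: x :: p]; rewrite cardsE (card_uniqP p_uniq) /= p_r.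
rewrite leq_eqVlt => /predU1P[G_r | G_r].
  apply: leq_trans (geq_minr _ _) _; rewrite -{1}G_r /= mulnC -p_r.
  rewrite -sum_nat_const; apply: leq_sum => v _.
  exact: ecc3_ge_path p_uniq.
apply: leq_trans (geq_minl _ _) _.
(* [q] lists the [r] interior vertices, the only ones whose lower bound drops from [r.+2] to
   [r.+1]. *)
case: (lastP p) => [|q y] in p_r p_uniq x_p *; first by [].
have q_r : size q = r by move: p_r; rewrite size_rcons => -[].
have /subsetPn[z _ zp] : ~~ ([set: G] \subset [set:: x :: rcons q y]).
  apply/negP=> /subset_leq_card; rewrite cardsT cardsE (card_uniqP p_uniq) /=.
  by rewrite size_rcons q_r leqNgt G_r.
rewrite inE in zp; rewrite leq_subLR.
have <- : \sum_(v : G) r.+2 = r.+2 * #|G| by rewrite sum_nat_const mulnC.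
have q_card : \sum_(v : G) (v \in q : nat) <= r.
  rewrite (eq_bigr (fun v => if v \in q then 1 else 0)) => [|v _].
    by rewrite -big_mkcond sum1_card -q_r card_size.
  by case: (v \in q).
apply: leq_trans (leq_add q_card (leqnn _)); rewrite -big_split.
apply: leq_sum => v _ /=; case: (boolP (v \in q)) => v_q.
  by rewrite -p_r; apply: ecc3_ge_path p_uniq.
rewrite -p_r add0n; case: (boolP (v \in x :: rcons q y)) => v_p.
  apply: (ecc3_gt_path (z := z) treeG G3 x_p p_uniq zp).
  move: v_p; rewrite !inE mem_rcons inE last_rcons (negPf v_q) orbF.
  by case/orP=> ->; rewrite ?orbT.
by apply: (ecc3_gt_path (z := v) treeG G3 x_p p_uniq v_p); rewrite inE eqxx.
Qed.

(** Orients an edge avoiding [c] away from [c]: the path from [c] to the farther end [v] finishes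
    with this edge and has length at least 2. *)
Lemma tree_edge_path (G : sgraph) (c x y : G) :
  is_tree G -> adj x y -> x != c -> y != c ->
  exists (u v : G) q,
    [set u; v] = [set x; y] /\ simple_path c v (rcons (rcons q u) v).
Proof.
move=> [Gconn acG] xy xc yc.
suff far u v p : u != c -> simple_path u c p -> simple_path v c (u :: p) ->
    exists q, simple_path c v (rcons (rcons q u) v).
  have [p xp] := tree_simple_path x c Gconn.
  have [yp | [q eq_p yq]] := simple_path_adj acG xy xp.
    by have [q] := far x y p xc xp yp; exists x, y, q.
  rewrite eq_p in xp; have [r] := far y x q yc yq xp.
  by exists y, x, r; rewrite setUC.
case: p => [|a p] uc; first by case/and3P=> _ /=; rewrite (negPf uc).
move=> _ /simple_path_rev; rewrite /= !rev_cons => ?.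
by exists (rev (belast a p)).
Qed.

(** An edge avoiding the middle vertex [c] would end an arm of length at least 2 from [c]; [x0] or
    [x2] extends it beyond [c] to a path with 3 edges. *)
Lemma alpha_no_path3 (G : sgraph) :
  is_tree G -> has_path G 2 -> ~ has_path G 3 -> #|G| <= (alpha G).+1.
Proof.
move=> treeG [x0 [p [x_p p_uniq p2]]] noP.
case: p p2 x_p p_uniq => [|c [|x2 []]] // _.
move=> /and3P[x0c cx2 _] /and3P[Nx0 Nc _]; rewrite !inE negb_or in Nx0 Nc.
case/andP: Nx0 => Nx0c Nx02.
rewrite -cardsT (cardsD1 c) inE add1n ltnS.
apply: independent_card => x y; rewrite !inE !andbT => xc yc.
apply/negP=> /(tree_edge_path treeG)/(_ xc yc)[u [v [q [_ cq]]]].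
have acG := treeG.2.
have P0 : simple_path c x0 [:: x0].
  by rewrite /simple_path /= adj_sym x0c eqxx inE eq_sym Nx0c.
have P2 : simple_path c x2 [:: x2].
  by rewrite /simple_path /= cx2 eqxx inE Nc.
have size_ge h : (size (rcons (rcons q u) v)) + (@size h [::]).+1 >= 3.
  by rewrite !size_rcons addn1 !ltnS.
apply: noP; case: (eqVneq x0 (head c (rcons (rcons q u) v))) => hq.
  apply: has_path_le (size_ge _) _.
  by apply: (has_path_join acG cq P2); rewrite -hq eq_sym.
apply: has_path_le (size_ge _) _.
exact: has_path_join acG cq P0 hq.
Qed.

(** An edge avoiding [a] and [b] would end an arm from [a]. If the arm starts with [b] it has length
    at least 3 and [x0] extends it; otherwise it has length at least 2 and is extended by [b],
    [x3]. *)
Lemma alpha_no_path4 (G : sgraph) :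
  is_tree G -> has_path G 3 -> ~ has_path G 4 -> #|G| <= (alpha G).+2.
Proof.
move=> treeG [x0 [p [x_p p_uniq p3]]] noP.
case: p p3 x_p p_uniq => [|a [|b [|x3 []]]] // _.
move=> /and4P[x0a ab bx3 _] /and4P[Nx0 Na Nb _].
rewrite !inE !negb_or in Nx0 Na Nb.
case/and3P: Nx0 => Nx0a Nx0b Nx03; case/andP: Na => Nab Nax3.
have eq_card : #|[set: G] :\ a :\ b|.+2 = #|G|.
  rewrite -cardsT (cardsD1 a [set: G]) (cardsD1 b ([set: G] :\ a)) !inE.
  by rewrite [b == a]eq_sym Nab.
rewrite -eq_card !ltnS; apply: independent_card => x y.
rewrite !inE !andbT => /andP[xb xa] /andP[yb ya].
apply/negP=> /(tree_edge_path treeG)/(_ xa ya)[u [v [q [eq_uv aq]]]].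
have ub : u != b by have := set21 u v; rewrite eq_uv !inE => /orP[]/eqP->.
have acG := treeG.2; apply: noP.
have P0 : simple_path a x0 [:: x0].
  by rewrite /simple_path /= adj_sym x0a eqxx inE eq_sym Nx0a.
have P3 : simple_path a x3 [:: b; x3].
  by rewrite /simple_path /= ab bx3 eqxx !inE negb_or Nab Nax3 Nb.
case: (eqVneq b (head a (rcons (rcons q u) v))) => hq.
  have q_gt0 : 0 < size q by case: q hq {aq} => //= u_b; rewrite u_b eqxx in ub.
  apply: has_path_le (has_path_join acG aq P0 _); last by rewrite -hq.
  by rewrite !size_rcons /= addn1 !ltnS.
apply: has_path_le (has_path_join acG aq P3 hq).
by rewrite !size_rcons /= addn2 !ltnS.
Qed.

Lemma sum_ecc3_ge_path4 (G : sgraph) :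
  is_tree G -> has_path G 4 -> ~ has_path G 5 -> 4 + alpha G <= #|G| ->
  6 * #|G| <= \sum_(v : G) ecc3 v + (alpha G).+2.
Proof.
move=> treeG [x0 [p [x_p p_uniq p4]]] noP le_alpha.
have G3 : 3 <= #|G| by apply: leq_trans le_alpha.
case: p p4 x_p p_uniq => [|x1 [|c [|x3 [|x4 []]]]] // _ x_p p_uniq.
have acG := treeG.2.
pose N := [set u | adj c u].
pose Q := [set u in N | [exists w, (w != c) && adj u w]].
(* A longer arm, joined to the half of the given path that leaves [c] through another edge, would
   have 5 edges. *)
have arms x q : simple_path c x q -> size q <= 2.
  move=> cq; rewrite leqNgt; apply/negP=> q3; apply: noP.
  move/and5P: x_p => [x01 x1c cx3 x34 _].
  move: p_uniq => /and5P[]; rewrite !inE !negb_or.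
  move=> /and4P[N01 N0c N03 N04] /and3P[N1c N13 N14] /andP[Nc3 Nc4] N34 _.
  have P0 : simple_path c x0 [:: x1; x0].
    rewrite /simple_path /= adj_sym x1c adj_sym x01 eqxx !inE negb_or.
    by rewrite ![c == _]eq_sym N1c N0c eq_sym N01.
  have P4 : simple_path c x4 [:: x3; x4].
    by rewrite /simple_path /= cx3 x34 eqxx !inE negb_or Nc3 Nc4 N34.
  case: (eqVneq x1 (head c q)) => hq.
    apply: has_path_le (has_path_join acG cq P4 _); last by rewrite -hq eq_sym.
    by rewrite /= addn2 !ltnS.
  apply: has_path_le (has_path_join acG cq P0 hq).
  by rewrite /= addn2 !ltnS.
have adj_neq (x y : G) : adj x y -> x != y.
  by move=> xy; apply: contraTneq xy => ->; rewrite adj_irrefl.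
have depth z : z != c -> z \notin N -> exists2 u, u \in N & adj u z.
  move=> zc zN; have [q cq] := tree_simple_path c z treeG.1.
  have := arms _ _ cq; case/and3P: cq => c_q /eqP.
  case: q c_q => [_ /= eq_cz | u [|w []]] //.
  - by rewrite eq_cz eqxx in zc.
  - by rewrite /= andbT => cu eq_uz; rewrite -eq_uz inE cu in zN.
  by move=> /and3P[cu uw _] /= <- _ _; exists u; rewrite ?inE.
have N_indep x y : x \in N -> y \in N -> ~~ adj x y.
  rewrite !inE => cx cy; apply/negP=> xy.
  have /(nbwalk_uniq acG) : nbwalk [:: c; x; y; c].
    rewrite /= cx xy [adj y c]adj_sym cy (adj_neq _ _ cy) eq_sym.
    by rewrite (adj_neq _ _ cx).
  by rewrite /= !inE eqxx !orbT.
have N_alpha : #|N| <= alpha G by apply: independent_card.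
have Q_card : 3 <= #|Q|.
  (* Arms have length at most 2, so an edge avoiding [c] has its nearer end in [N], hence in [Q]. *)
  have I_alpha : #|~: (c |: Q)| <= alpha G.
    apply: independent_card => x y.
    rewrite !in_setC !in_setU1 !negb_or => /andP[xc xQ] /andP[yc yQ].
    apply/negP=> /(tree_edge_path treeG)/(_ xc yc)[u [v [q [eq_uv cq]]]].
    have [uQ vc] : u \notin Q /\ v != c.
      have := set21 u v; have := set22 u v; rewrite eq_uv !in_set2.
      by move=> /orP[]/eqP-> /orP[]/eqP->.
    have := arms _ _ cq; rewrite !size_rcons !ltnS leqn0 size_eq0 => /eqP q0.
    move: cq; rewrite q0 => /and3P[/and3P[cu uv _] _ _].
    case/negP: uQ; rewrite !inE cu; apply/existsP; exists v.
    by rewrite vc.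
  (* [c], [Q] and an independent remainder exhaust [G], so [4 + alpha G <= #|G|] leaves at least
     three vertices for [Q]. *)
  have := cardsC (c |: Q); rewrite cardsU1 !inE adj_irrefl /= add1n.
  move=> eq_card; rewrite -ltnS -(leq_add2r (alpha G)).
  by apply: leq_trans le_alpha _; rewrite -eq_card leq_add2l.
have QP u : u \in Q -> exists w, [/\ u \in N, w != c & adj u w].
  by rewrite inE => /andP[uN /existsP[w /andP[wc uw]]]; exists w.
have walk w a b w' : a != b -> [/\ a \in N, w != c & adj a w] ->
    [/\ b \in N, w' != c & adj b w'] ->
    path (@adj G) w [:: a; c; b; w'] /\ uniq [:: w; a; c; b; w'].
  rewrite !inE => ab [ca wc aw] [cb w'c bw'].
  suff nbw : nbwalk [:: w; a; c; b; w'].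
    by split; [exact: (nbwalk_path nbw) | exact: (nbwalk_uniq acG nbw)].
  by rewrite /= adj_sym aw wc adj_sym ca ab cb eq_sym w'c bw'.
have Q2 u : exists u1 u2,
    [/\ u1 \in Q, u2 \in Q & [/\ u1 != u, u2 != u & u1 != u2]].
  have : 1 < #|Q :\ u| by move: Q_card; rewrite (cardsD1 u); case: (u \in Q); lia.
  case/card_gt1P=> u1 [u2 []]; rewrite !inE => /andP[u1u u1Q] /andP[u2u u2Q] u12.
  by exists u1, u2; rewrite !inE.
have ecc_le v : 6 <= ecc3 v + ((v \in N) + (v == c) * 2).
  case: (eqVneq v c) => [-> | vc].
    rewrite inE adj_irrefl -[6]/(4 + 2) leq_add2r.
    exact: (ecc3_ge_path _ treeG G3 x_p p_uniq).
  case: (boolP (v \in N)) => vN; rewrite ?addn1 ?addn0 ?ltnS.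
    (* The 5-vertex path [w], [a], [c], [b], [w'] misses [v], because [N] is independent. *)
    have [a [b [/QP[w aP] /QP[w' bP] [av bv ab]]]] := Q2 v.
    have [w_p p_w] := walk _ _ _ _ ab aP bP.
    apply: (ecc3_gt_path (z := v) treeG G3 w_p p_w); last by rewrite inE eqxx.
    have [aN _ aw] := aP; have [bN _ bw] := bP.
    rewrite !inE (negPf vc) ![v == _]eq_sym (negPf av) (negPf bv) /=.
    apply/norP; split; first by apply: contraTneq aw => ->; apply: N_indep.
    by apply: contraTneq bw => ->; apply: N_indep.
  have [u uN uv] := depth v vc vN.
  (* The arms through [u], [a] and [b] meet only at [c], so the hull of [v], [w], [w'] has seven
     vertices. *)
  have [a [b [/QP[w aP] /QP[w' bP] [au bu ab]]]] := Q2 u.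
  have [w_p p_w] := walk _ _ _ _ ab aP bP.
  have uP : [/\ u \in N, v != c & adj u v] by [].
  rewrite eq_sym in au; rewrite eq_sym in bu.
  have [v_pa p_va] := walk _ _ _ _ au uP aP.
  have [v_pb p_vb] := walk _ _ _ _ bu uP bP.
  rewrite -ltnS -[7]/(size [:: v, u & [:: w; a; c; b; w']]).
  apply: (@ecc3_ge _ _ [:: v; w; w']) => //; first by rewrite inE eqxx.
    case/and3P: p_va => va ua _; case/and3P: p_vb => vb ub _.
    rewrite cons_uniq [in X in _ && X]cons_uniq p_w andbT.
    move: va ua vb ub; rewrite !inE !negb_or.
    move=> /and4P[-> -> -> ->] /and3P[-> -> ->].
    by move=> /and4P[_ _ -> ->] /and3P[_ -> ->].
  move=> z; rewrite -[_ :: _]/([:: v; u] ++ _) mem_cat => /orP[z_vu | z_p].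
    exists v, w, [:: u; c; a; w]; rewrite !inE !eqxx ?orbT; split=> //.
      by apply/and3P.
    by move: z_vu; rewrite !inE => /orP[]->; rewrite ?orbT.
  exists w, w', [:: a; c; b; w']; split=> //; last exact/and3P.
    by rewrite !inE eqxx orbT.
  by rewrite !inE eqxx !orbT.
have c_card : \sum_(v : G) (v == c) * 2 = 2.
  by rewrite (bigD1 c) //= eqxx big1 // => v /negPf->.
have N_card : \sum_(v : G) (v \in N : nat) = #|N|.
  by rewrite -sum1_card [RHS]big_mkcond; apply: eq_bigr => v _; case: (v \in N).
have : \sum_(v : G) 6 <= \sum_(v : G) (ecc3 v + ((v \in N) + (v == c) * 2)).
  exact: leq_sum.
rewrite sum_nat_const mulnC big_split /= big_split /= c_card N_card.
by move/leq_trans; apply; rewrite -[(alpha G).+2]addn2 leq_add2l leq_add2r.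
Qed.

(** * Upper bounds for T_{n,m} *)

Section Spider.

Variables n m : nat.
Hypothesis lt_mn : m < n.
Hypothesis le_n2m : n - m - 1 <= m.

Let k := n - m - 1.
Let c : Tnm n m := inl (inl tt).

(** The tree is rooted at the centre, which is its own parent, so two parent steps from any vertex
    end at the centre. *)
Definition spider_parent (x : Tnm n m) : Tnm n m :=
  if x is inr j then inl (inr (widen_ord le_n2m j)) else inl (inl tt).

Definition spider_feet : {set Tnm n m} :=
  [set x | if x is inr _ then true else false].

Lemma spider_adj_parent (x : Tnm n m) : x != c -> adj x (spider_parent x).
Proof. by case: x => [[[]|i]|j] //= _; apply/eqP. Qed.

Lemma spider_connect (U : {set Tnm n m}) (e : rel (Tnm n m)) :
  (forall x, x \in U -> spider_parent x \in U) ->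
  (forall x, x \in U -> x != c -> e x (spider_parent x)) ->
  connect_sym e -> forall x y, x \in U -> y \in U -> connect e x y.
Proof.
move=> U_par e_par e_sym.
have step x : x \in U -> connect e x (spider_parent x).
  move=> xU; case: (eqVneq x c) => [-> | xc]; first exact: connect0.
  exact: connect1 (e_par x xU xc).
have to_c x : x \in U -> connect e x c.
  move=> xU; have := connect_trans (step _ xU) (step _ (U_par _ xU)).
  by case: x xU => [[[]|i]|j].
move=> x y xU yU; apply: connect_trans (to_c x xU) _.
by rewrite e_sym; apply: to_c.
Qed.

Lemma Tnm_connected : connected (Tnm n m).
Proof.
split; first by rewrite card_Tnm //; apply: leq_ltn_trans lt_mn.
move=> x y; apply: (@spider_connect [set: Tnm n m]); rewrite ?inE //.
  by move=> z _; apply: spider_adj_parent.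
exact/sym_connect_sym/adj_sym.
Qed.

Lemma steiner_dist_Tnm_le (S U : {set Tnm n m}) :
  c \in U -> S \subset U -> (forall x, x \in U -> spider_parent x \in U) ->
  steiner_dist S <= #|U :\ c|.
Proof.
move=> cU sSU U_par.
(* As [U] is closed under parents, the parent edges of its vertices other than [c] connect it. *)
pose F := [set [set x; spider_parent x] | x in U :\ c].
apply: leq_trans (leq_imset_card _ _ : #|F| <= _).
apply: (@steiner_dist_le _ _ (U, F) Tnm_connected).
apply/and3P; split=> //.
  apply/andP; split.
    apply/subsetP=> _ /imsetP[x /setD1P[xc _] ->].
    by rewrite edges_adj spider_adj_parent.
  apply/forall_inP=> _ /imsetP[x /setD1P[_ xU] ->].
  by apply/subsetP=> y /set2P[]->; last exact: U_par.
apply/andP; split; first by apply/set0Pn; exists c.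
apply/forall_inP=> x xU; apply/forall_inP=> y yU.
apply: (@spider_connect U) => //.
  by move=> z zU zc; apply/imsetP; exists z => //; apply/setD1P.
by apply: sym_connect_sym => u v; rewrite setUC.
Qed.

(* The hull of S consists of c, S and the parents of the feet in S; the
   second term counts those parents that are not already in S. *)
Lemma steiner_dist_Tnm (S : {set Tnm n m}) :
  steiner_dist S <=
    #|S :\ c| + #|(spider_parent @: (S :&: spider_feet)) :\: S|.
Proof.
pose P := spider_parent @: (S :&: spider_feet).
apply: leq_trans (@steiner_dist_Tnm_le S (c |: (S :|: P)) _ _ _) _.
- exact: setU11.
- by rewrite setUCA subsetUl.
- move=> x; rewrite !inE => /or3P[/eqP-> // | xS | /imsetP[y _ ->]]; last first.
    by case: y => [[[]|i]|j].
  case: x xS => [[[]|i]|j] // xS; apply/orP; right; apply/orP; right.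
  by apply/imsetP; exists (inr j); rewrite ?inE ?xS.
apply: leq_trans (subset_leq_card (_ : _ \subset (S :\ c) :|: (P :\: S))) _.
  apply/subsetP=> x; rewrite !inE => /andP[xc]; rewrite (negPf xc) /=.
  by case: (x \in S).
exact: leq_card_setU.
Qed.

Lemma ecc3_Tnm_le_pred (v : Tnm n m) : ecc3 v <= n.-1.
Proof.
apply/bigop.bigmax_leqP=> S _.
apply: leq_trans (@steiner_dist_Tnm_le S setT _ _ _) _; rewrite ?inE //.
by have := card_Tnm lt_mn; rewrite -cardsT (cardsD1 c) inE => /(congr1 predn) <-.
Qed.

Lemma card_spider_feet : #|spider_feet| = k.
Proof.
have -> : spider_feet = [set inr j | j in 'I_k].
  apply/setP=> x; rewrite inE; apply/idP/imsetP => [|[j _ ->] //].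
  by case: x => // j _; exists j.
by rewrite card_imset ?card_ord //; apply: inr_inj.
Qed.

(** Each counted parent comes from a foot in [S]: possibly [v], at most two others, and at most [k]
    in all. *)
Lemma spider_legs_card (S : {set Tnm n m}) (v : Tnm n m) :
  v \in S -> #|S| = 3 ->
  #|(spider_parent @: (S :&: spider_feet)) :\: S| <=
     minn ((v \in spider_feet) + 2) k.
Proof.
move=> vS S3; apply: leq_trans (subset_leq_card (subsetDl _ _)) _.
apply: leq_trans (leq_imset_card _ _) _.
rewrite leq_min -card_spider_feet (subset_leq_card (subsetIr _ _)) andbT.
rewrite (cardsD1 v) inE vS leq_add2l.
have -> : 2 = #|S :\ v| by move: S3; rewrite (cardsD1 v) vS => -[].
by rewrite subset_leq_card // setSD ?subsetIl.
Qed.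

Lemma ecc3_Tnm_centre : ecc3 c <= 2 + minn 2 k.
Proof.
apply/bigop.bigmax_leqP=> S /andP[cS /eqP S3].
apply: leq_trans (steiner_dist_Tnm S) _; apply: leq_add.
  by move: S3; rewrite (cardsD1 c) cS add1n => -[->].
by apply: leq_trans (spider_legs_card cS S3) _; rewrite inE.
Qed.

Lemma ecc3_Tnm_foot (j : 'I_k) : ecc3 (inr j : Tnm n m) <= 3 + minn 3 k.
Proof.
apply/bigop.bigmax_leqP=> S /andP[vS /eqP S3].
apply: leq_trans (steiner_dist_Tnm S) _; apply: leq_add.
  by rewrite -S3 subset_leq_card // subsetDl.
by apply: leq_trans (spider_legs_card vS S3) _; rewrite inE.
Qed.

(** The correction term is for a knee that carries a foot when [k <= 2]: that foot's parent is [v]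
    itself, so only [k.-1] feet can contribute a new parent. *)
Lemma ecc3_Tnm_knee (i : 'I_m) :
  ecc3 (inl (inr i) : Tnm n m) + (i < k) * (k <= 2) <= 3 + minn 2 k.
Proof.
rewrite addnC -leq_subRL; last first.
  by apply: leq_trans (leq_addr _ _); case: (i < k); case: (k <= 2).
apply/bigop.bigmax_leqP=> S /andP[vS /eqP S3].
apply: leq_trans (steiner_dist_Tnm S) _.
rewrite -addnBA; last first.
  by case: ltnP => // ik; rewrite leq_min; case: (k <= 2) => //; lia.
apply: leq_add; first by rewrite -S3 subset_leq_card // subsetDl.
have := spider_legs_card vS S3; rewrite inE add0n => le_2k.
case: (ltnP i k) => [ik | _]; last by rewrite mul0n subn0.
move: le_2k; case: (leqP k 2) => _ le_2k; last by rewrite muln0 subn0.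
rewrite mul1n subn1.
pose w : Tnm n m := inr (Ordinal ik).
have <- : #|spider_feet :\ w| = k.-1.
  by have := card_spider_feet; rewrite (cardsD1 w) inE => <-.
apply: leq_trans (leq_imset_card spider_parent _).
apply: subset_leq_card; apply/subsetP=> x /setDP[/imsetP[y]].
rewrite inE => /andP[_ yF] -> yS; apply: imset_f; rewrite inE yF andbT inE.
apply: contraNneq yS => ->.
suff -> : spider_parent w = inl (inr i) by [].
by congr (inl (inr _)); apply: val_inj.
Qed.

(** The subtracted term collects the shortfalls from [3 + minn 3 k]: for [k <= 2], one at the centre
    and one at each knee with a foot; otherwise two at the centre and one at each knee. *)
Lemma sum_ecc3_Tnm_le :
  \sum_(v : Tnm n m) ecc3 v + (if k <= 2 then k.+1 else m.+2) <=
    (3 + minn 3 k) * n.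
Proof.
have -> : \sum_(v : Tnm n m) ecc3 v = ecc3 c
    + \sum_(i < m) ecc3 (inl (inr i) : Tnm n m)
    + \sum_(j < k) ecc3 (inr j : Tnm n m).
  rewrite (big_sumType _ _ (fun v : Tnm n m => ecc3 v)) big_sumType.
  by rewrite (big_pred1 tt) => [|[]].
have legs : \sum_(i < m) (i < k) * (k <= 2) = k * (k <= 2).
  rewrite -big_distrl /=; congr (_ * _).
  rewrite -[RHS](card_ord k) -sum1_card.
  rewrite (big_ord_widen m (fun=> 1) le_n2m) [RHS]big_mkcond.
  by apply: eq_bigr => i _; case: (i < k).
have knees : \sum_(i < m) ecc3 (inl (inr i) : Tnm n m) + k * (k <= 2)
    <= m * (3 + minn 2 k).
  rewrite -legs -big_split -[m in m * _]card_ord -sum_nat_const.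
  by apply: leq_sum => i _; apply: ecc3_Tnm_knee.
have feet : \sum_(j < k) ecc3 (inr j : Tnm n m) <= k * (3 + minn 3 k).
  rewrite -[k in k * _]card_ord -sum_nat_const.
  by apply: leq_sum => j _; apply: ecc3_Tnm_foot.
have := ecc3_Tnm_centre; move: knees feet.
move: (\sum_(i < m) _) (\sum_(j < k) _) (ecc3 c) => sk sf sc.
have -> : n = (m + k).+1 by rewrite /k; lia.
by case: k => [|[|[|k']]] /=; rewrite ?muln0 ?muln1; lia.
Qed.

End Spider.

(** * Comparison of the two sums *)

Lemma has_path_dec (G : sgraph) k : has_path G k \/ ~ has_path G k.
Proof.
case: (boolP [exists x : G, exists t : k.-tuple G,
                path (@adj G) x t && uniq (x :: t)]) => [|noP].
  case/existsP=> x /existsP[t /andP[x_t t_uniq]]; left.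
  by exists x, t; rewrite size_tuple.
right=> -[x [p [x_p p_uniq /eqP p_k]]]; case/existsP: noP; exists x.
by apply/existsP; exists (Tuple p_k); rewrite /= x_p.
Qed.

(** Of three distinct vertices, either two are non-adjacent and the path between them is long
    enough, or consecutive ones are adjacent. *)
Lemma has_path2 (G : sgraph) : connected G -> 3 <= #|G| -> has_path G 2.
Proof.
move=> Gconn /card_gt2P[x [y [z [_ [xy yz zx]]]]].
have near (u v : G) : u != v -> has_path G 2 \/ adj u v.
  move=> uv; have [p up] := tree_simple_path u v Gconn.
  case: p up => [|w [|w' p]] /and3P[u_p /eqP p_v p_uniq].
  - by rewrite -p_v eqxx in uv.
  - by right; move: u_p; rewrite /= andbT -p_v.
  by left; apply: (@has_path_le _ (size p).+2) => //; exists u, [:: w, w' & p].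
have [//|adj_xy] := near _ _ xy; have [//|adj_yz] := near _ _ yz.
exists x, [:: y; z]; rewrite /= adj_xy adj_yz !inE negb_or xy yz.
by rewrite eq_sym zx.
Qed.

(** The first four bounds have the form [r.+2 * n - r] for [r] from 4 down to 1, matching the lower
    bound from a path with [r.+1] edges; the last matches the case of depth 2 with [k >= 3]. *)
Lemma spider_bound_cases n a s (k := n - a - 1) :
  3 <= n -> a < n -> n <= a.*2 ->
  s + (if k <= 2 then k.+1 else a.+2) <= (3 + minn 3 k) * n ->
  [/\ s <= 6 * n - 4, n <= a + 3 -> s <= 5 * n - 3, n <= a + 2 -> s <= 4 * n - 2,
      n <= a + 1 -> s <= 3 * n - 1 & a + 4 <= n -> s + a.+2 <= 6 * n].
Proof.
move=> n3 an n2a; have n_eq : n = (a + k).+1 by rewrite /k; lia.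
move: k n_eq => k n_eq; case: k n_eq => [|[|[|k]]] n_eq /= le_s; split; lia.
Qed.

Lemma sum_ecc3_Tnm_alpha_le (G : sgraph) :
  is_tree G -> 3 <= #|G| ->
  \sum_(v : Tnm #|G| (alpha G)) ecc3 v <= \sum_(v : G) ecc3 v.
Proof.
move=> treeG G3; have Gconn := treeG.1.
have lt_alpha : alpha G < #|G| by apply: alpha_lt => //; apply: ltnW.
have le_2alpha := tree_card_le_2alpha treeG.
have kG : #|G| - alpha G - 1 <= alpha G by lia.
have := sum_ecc3_Tnm_le lt_alpha kG.
(* This bound matches the spanning-path term of the minimum. *)
have : \sum_(v : Tnm #|G| (alpha G)) ecc3 v <= #|G|.-1 * #|G|.
  rewrite -[X in _ * X](card_Tnm lt_alpha) mulnC -sum_nat_const.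
  by apply: leq_sum => v _; apply: ecc3_Tnm_le_pred.
have P2 := has_path2 Gconn G3.
move=> le_n /(spider_bound_cases G3 lt_alpha le_2alpha)[le6 le5 le4 le3 le6'].
have path_le r s : has_path G r.+1 -> s <= r.+2 * #|G| - r ->
    s <= #|G|.-1 * #|G| -> s <= \sum_(v : G) ecc3 v.
  move=> Pr s_r s_n; apply: leq_trans (sum_ecc3_ge treeG G3 Pr).
  by rewrite leq_min s_r.
have [P5|noP5] := has_path_dec G 5; first exact: path_le P5 le6 le_n.
have [P4|noP4] := has_path_dec G 4.
  case: (leqP (alpha G + 4) #|G|) => G4; last first.
    by apply: (path_le _ _ P4) le_n; apply: le5; rewrite -ltnS -addnS.
  rewrite -(leq_add2r (alpha G).+2); apply: leq_trans (le6' G4) _.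
  by apply: sum_ecc3_ge_path4; rewrite // addnC.
have [P3|noP3] := has_path_dec G 3.
  apply: (path_le _ _ P3) le_n; apply: le4.
  by rewrite addn2; apply: alpha_no_path4.
apply: (path_le _ _ P2) le_n; apply: le3.
by rewrite addn1; apply: alpha_no_path3.
Qed.

Theorem theorem5p6 (T : sgraph) (n : nat) (treeT : is_tree T)
    (orderT : #|T| = n) (n_ge3 : (3 <= n)%N) :
  (aecc3 (Tnm n (alpha T)) <= aecc3 T)%R.
Proof.
rewrite -orderT in n_ge3 *; have lt_alpha := alpha_lt treeT.1 (ltnW n_ge3).
rewrite /aecc3 (card_Tnm lt_alpha) ler_wpM2r ?invr_ge0 ?ler0n //.
by rewrite ler_nat sum_ecc3_Tnm_alpha_le.
Qed.
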